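(* Let $g\ge2$ be a fixed base and let $q\ge 2$ be a fixed integer. Suppose there exist constants $A\ge 1$ and $\sqrt{2/3}\le \xi<1$, depending only on $q$, such that $$\left|\#\{n\in\mathcal P_L : n\equiv a \pmod q\}-\frac{\#\mathcal P_L}{q}\right|\le \#\mathcal P_L\cdot A\,\xi^L$$ for all integers $L\ge1$ and all $a\in\mathbb Z$. Then there is a constant $B\ge 1$ depending only on $g$ such that for all real $x\ge1$ and all $a\in\mathbb Z$, $$\left|\#\{n\in\mathcal P(x): n\equiv a\pmod q\}-\frac{\#\mathcal P(x)}{q}\right|\le \#\mathcal P(x)\cdot AB\,\xi^{(\log x)/(2\log g)}.$$
   Context: Fix an integer base $g\ge 2$. Every natural number $n$ has a base $g$ representation $n=\sum_{k=0}^{L-1}a_k(n)g^k$ with digits in $\{0,\dots,g-1\}$ and leading digit $a_{L-1}(n)\ne0$; $n$ is a palindrome if $a_k(n)=a_{L-1-k}(n)$ for all $k$. $\mathcal P$ is the set of base-$g$ palindromes, $\mathcal P(x)=\{n\le x: n\in\mathcal P\}$, and for $L\ge1$, $\mathcal P_L=\{n\in\mathcal P: g^{L-1}\le n<g^L\}$ is the set of palindromes with exactly $L$ digits. $\#S$ denotes cardinality. *)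

(* Defs.v *)
From mathcomp Require Export all_boot all_order all_algebra.
From mathcomp Require Export boolp classical_sets cardinality reals exp.
From mathcomp Require Export finmap.
Set Implicit Arguments.
Unset Strict Implicit.
Unset Printing Implicit Defensive.
Import Order.TTheory GRing.Theory Num.Theory.
Local Open Scope classical_set_scope.
Local Open Scope ring_scope.

(* [0 < L] together with a nonzero leading digit forces [0 < n]. *)
Definition base_repr (g n L : nat) (a : nat -> nat) : Prop :=
  [/\ (0 < L)%N,
      forall k, (k < L)%N -> (a k < g)%N,
      a L.-1 <> 0%N
    & n = (\sum_(k < L) a k * g ^ k)%N].

Definition palindromes (g : nat) : set nat :=
  [set n | exists L a, base_repr g n L a /\
             forall k, (k < L)%N -> a k = a (L - 1 - k)%N].

Definition palindromes_upto (R : realType) (g : nat) (x : R) : set nat :=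
  [set n | palindromes g n /\ n%:R <= x].

Definition palindromes_len (g L : nat) : set nat :=
  [set n | palindromes g n /\ (g ^ (L - 1) <= n < g ^ L)%N].

Definition residue_class (q : nat) (a : int) : set nat :=
  [set n | (n%:Z = a %[mod q%:Z])%Z].

(* [fset_set] sends infinite sets to the empty one; the finiteness lemmas below
   show that this junk value is never reached here. *)
Definition setcard (S : set nat) : nat := #|` fset_set S|.

Lemma finite_palindromes_upto (R : realType) (g : nat) (x : R) :
  finite_set (palindromes_upto g x).
Proof.
apply: (@sub_finite_set _ _ `I_(Num.truncn x).+1) (finite_II _).
move=> n [_ nx] /=; rewrite ltnS.
have x0 : 0 <= x by apply: le_trans nx; rewrite ler0n.
by rewrite truncn_ge_nat.
Qed.

Lemma finite_palindromes_len (g L : nat) : finite_set (palindromes_len g L).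
Proof.
by apply: (@sub_finite_set _ _ `I_(g ^ L)) (finite_II _) => n [_ /andP[]].
Qed.

(* Main.v *)
(**
An [L]-digit palindrome is determined, monotonically, by its upper half
[u < g ^ uphalf L], so the palindromes up to [x] of the length [L] of [x] form
an initial segment in [u]. Cutting this segment into [g]-adic blocks leaves at
most [g] blocks of each size, and on a block the palindromes are an affine
image, of slope a power of [g], of all palindromic words of a shorter length.
Words with leading zeros are powers of [g] times palindromes, so the hypothesis
controls every block as soon as [g] is invertible modulo [q]; this
invertibility is itself forced by the hypothesis, because the last digit of a
palindrome is never zero. The errors sum to a geometric series dominated by its
last term [A * g ^ uphalf L * xi ^ L], since [g * xi ^ 2 >= 4 / 3], and
[g ^ uphalf L <= g ^ 2 * #P(x)].
*)

Require Import Defs.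
From mathcomp Require Import topology normedtype sequences.
From mathcomp Require Import zify ring lra.
Set Implicit Arguments.
Unset Strict Implicit.
Unset Printing Implicit Defensive.
Import Order.TTheory GRing.Theory Num.Theory.
Import numFieldNormedType.Exports.
Local Open Scope classical_set_scope.
Local Open Scope ring_scope.

(** * Palindromic words and their upper halves *)

(* The palindromic word of length [L], leading zeros allowed, whose upper
   [uphalf L] digits are those of [u]; the recursion peels off the outer digit. *)
Fixpoint pal_of_half (g L u : nat) {struct L} : nat :=
  match L with
  | 0 => 0
  | 1 => u
  | L'.+2 => u %/ g ^ uphalf L' * (g ^ L'.+1 + 1)
             + g * pal_of_half g L' (u %% g ^ uphalf L')
  end%N.

Lemma nat_ind_step2 (P : nat -> Prop) :
  P 0%N -> P 1%N -> (forall n, P n -> P n.+2) -> forall n, P n.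
Proof.
move=> P0 P1 PS n; suff [] : P n /\ P n.+1 by [].
by elim: n => // n [Pn PSn]; split=> //; exact: PS.
Qed.

Lemma pal_of_halfSS (g L u : nat) :
  pal_of_half g L.+2 u =
  (u %/ g ^ uphalf L * (g ^ L.+1 + 1)
   + g * pal_of_half g L (u %% g ^ uphalf L))%N.
Proof. by []. Qed.

Lemma pal_of_half_lt (g L u : nat) :
  (0 < g)%N -> (u < g ^ uphalf L)%N -> (pal_of_half g L u < g ^ L)%N.
Proof.
move=> g0; elim/nat_ind_step2: L u => [u _ //|u /= |L IH u uh].
  by [].
rewrite pal_of_halfSS; set G := (g ^ uphalf L)%N.
have G0 : (0 < G)%N by rewrite expn_gt0 g0.
have /IH := ltn_pmod u G0; rewrite -/G.
have : (u %/ G < g)%N by rewrite ltn_divLR // -expnS.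
rewrite !expnS; move: (_ %/ _)%N (pal_of_half _ _ _) (g ^ L)%N => d m H dg mH.
nia.
Qed.

(** The outer digit decides: raising it by one adds [g ^ L.+1 + 1], more than the inner part
    [g * pal_of_half g L _], always below [g ^ L.+1], can lose. *)
Lemma pal_of_half_mono (g L u v : nat) : (0 < g)%N ->
  (u < v)%N -> (v < g ^ uphalf L)%N ->
  (pal_of_half g L u < pal_of_half g L v)%N.
Proof.
move=> g0; elim/nat_ind_step2: L u v => [u v /= |u v //|L IH u v uv vh].
  by rewrite expn0 => uv v1; lia.
rewrite !pal_of_halfSS; set G := (g ^ uphalf L)%N.
have G0 : (0 < G)%N by rewrite expn_gt0 g0.
have um := ltn_pmod u G0; have vm := ltn_pmod v G0.
have := pal_of_half_lt g0 um; rewrite expnS.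
have : (u %/ G <= v %/ G)%N by rewrite leq_div2r // ltnW.
rewrite leq_eqVlt => /predU1P[e|lt] plt.
  have : (u %% G < v %% G)%N.
    by move: uv; rewrite {1}(divn_eq u G) {1}(divn_eq v G) e ltn_add2l.
  by move=> /IH /(_ vm); rewrite e ltn_add2l ltn_pmul2l.
move: lt plt; move: (pal_of_half _ _ _) (pal_of_half _ _ _) (g ^ L)%N => m' m H.
move: (u %/ G)%N (v %/ G)%N => d d' dd mH.
have h1 : (d.+1 * (g * H + 1) <= d' * (g * H + 1))%N by rewrite leq_mul2r dd orbT.
have h2 : (g * m <= g * H)%N by rewrite leq_mul2l (ltnW mH) orbT.
by move: h1; rewrite mulSn; lia.
Qed.

Lemma pal_of_half_inj (g L : nat) : (0 < g)%N ->
  {in [pred u | (u < g ^ uphalf L)%N] &, injective (pal_of_half g L)}.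
Proof.
move=> g0 u v; rewrite !inE => uh vh e.
case: (ltngtP u v) => // [uv|vu].
  by have := pal_of_half_mono g0 uv vh; rewrite e ltnn.
by have := pal_of_half_mono g0 vu uh; rewrite e ltnn.
Qed.

Lemma pal_of_half_ge (g L u : nat) : (0 < g)%N -> (0 < L)%N ->
  (u < g ^ uphalf L)%N ->
  (g ^ L.-1 <= pal_of_half g L u)%N = (g ^ (uphalf L).-1 <= u)%N.
Proof.
move=> g0; case: L => [//|[//|L]] _ uh; rewrite pal_of_halfSS /=.
set G := (g ^ uphalf L)%N.
have G0 : (0 < G)%N by rewrite expn_gt0 g0.
have := pal_of_half_lt g0 (ltn_pmod u G0).
have -> : (G <= u)%N = (0 < u %/ G)%N by rewrite divn_gt0.
rewrite -/G expnS; move: (pal_of_half _ _ _) (_ %/ _)%N (g ^ L)%N => m d H mH.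
by apply/idP/idP => h; nia.
Qed.

Lemma digit_sum_lt (g L : nat) (a : nat -> nat) :
  (forall k, (k < L)%N -> (a k < g)%N) -> (\sum_(k < L) a k * g ^ k < g ^ L)%N.
Proof.
elim: L => [_|L IH ag]; first by rewrite big_ord0.
rewrite big_ord_recr /= expnS.
have := IH (fun k h => ag k (ltnW h)); have := ag L (leqnn _).
by move: (\sum_(i < L) _)%N (a L) (g ^ L)%N => s d H; nia.
Qed.

(** Stripping the two outer digits of a palindrome can expose zeros, so the induction runs over
    words with leading zeros allowed. *)
Lemma palindromic_digitsP (g L n : nat) : (0 < g)%N ->
  (exists2 u, (u < g ^ uphalf L)%N & n = pal_of_half g L u) <->
  exists a : nat -> nat,
    [/\ forall k, (k < L)%N -> (a k < g)%N,
        forall k, (k < L)%N -> a k = a (L - 1 - k)%N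
      & n = (\sum_(k < L) a k * g ^ k)%N].
Proof.
move=> g0; elim/nat_ind_step2: L n => [n|n|L IH n].
- split=> [[u _ ->]|[a [_ _ ->]]].
    by exists (fun=> 0%N); split=> //; rewrite big_ord0.
  by exists 0%N => //; rewrite big_ord0.
- split=> [[u ug ->]|[a [ag _ ->]]].
    exists (fun=> u); split=> //; last by rewrite big_ord1 muln1.
  by exists (a 0%N); rewrite ?big_ord1 ?muln1 ?expn1 //= ; exact: ag.
have recE (a : nat -> nat) : (\sum_(k < L.+2) a k * g ^ k =
    a 0%N + g * (\sum_(k < L) a k.+1 * g ^ k) + a L.+1 * g ^ L.+1)%N.
  rewrite big_ord_recr big_ord_recl /= expn0 muln1 big_distrr /=; congr (_ + _ + _)%N.
  by apply: eq_bigr => i _; rewrite /bump /= add1n expnS; lia.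
have G0 : (0 < g ^ uphalf L)%N by rewrite expn_gt0 g0.
split=> [[u uh ->]|[a [ag ap ->]]].
  have [b [bg bp bE]] := (IH (pal_of_half g L (u %% g ^ uphalf L))).1
    (ex_intro2 _ _ (u %% g ^ uphalf L)%N (ltn_pmod u G0) erefl).
  have dg : (u %/ g ^ uphalf L < g)%N by rewrite ltn_divLR // -expnS.
  (* The outer digit of [u], wrapped around the digits [b] of the inner word. *)
  pose a k := if (k == 0%N) || (k == L.+1) then (u %/ g ^ uphalf L)%N
              else b k.-1.
  exists a; split; rewrite ?(recE a) /a.
  - by move=> [|k] /=; rewrite ?eqSS ?ltnS // => kL; case: eqP => // ?; apply: bg; lia.
  - move=> [|k] kL /=; first by rewrite subn0 subn1 /= eqxx.
    rewrite eqSS; case: eqP => [->|kn]; first by rewrite (_ : (_ - _ - _)%N = 0%N) //; lia.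
    case: ifPn => [|_]; first by lia.
    by rewrite bp; [congr b|]; lia.
  rewrite pal_of_halfSS bE /= eqxx.
  rewrite [in RHS](eq_bigr (fun k : 'I_L => b k * g ^ k)%N); first lia.
  by move=> i _; rewrite eqSS ltn_eqF.
have [|u uh uE] := (IH (\sum_(k < L) a k.+1 * g ^ k)%N).2.
  exists (fun k => a k.+1); split=> // k kL; first by apply: ag; lia.
  by rewrite ap; [congr a|]; lia.
have a0 := ag 0%N isT.
exists (a 0%N * g ^ uphalf L + u)%N.
  by rewrite /= expnS; nia.
rewrite recE pal_of_halfSS divnMDl // divn_small // modnMDl modn_small // -uE.
by rewrite -[a L.+1](ap 0%N) //; lia.
Qed.

Lemma palindromes_lenE (g L : nat) : (1 < g)%N -> (0 < L)%N ->
  palindromes_len g L =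
  [set pal_of_half g L u | u in
     [set u | (g ^ (uphalf L).-1 <= u < g ^ uphalf L)%N]].
Proof.
move=> g1 L0; have g0 := ltnW g1; apply/seteqP; split=> n /=.
  move=> [[M [a [[M0 ag aN nE] ap]]] /andP[nl nu]].
  have nM : (n < g ^ M)%N by rewrite nE; exact: digit_sum_lt.
  have Mn : (g ^ M.-1 <= n)%N.
    rewrite nE; case: (M) M0 aN => // m _ /eqP; rewrite -lt0n => am.
    by rewrite big_ord_recr /= (leq_trans (leq_pmull _ am)) // leq_addl.
  (* The bounds on [n] by powers of [g] force the two digit counts to agree. *)
  have := leq_ltn_trans nl nM; have := leq_ltn_trans Mn nu.
  rewrite !ltn_exp2l // => h1 h2; have ML : M = L by lia.
  move: {h1 h2 nM Mn} ML M0 ag aN nE ap => {M} -> _ ag aN nE ap.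
  have [u uh uE] := (palindromic_digitsP L n g0).2
     (ex_intro _ a (And3 ag ap nE)).
  exists u => //; rewrite uh andbT -(pal_of_half_ge g0 L0 uh) -uE.
  by rewrite -subn1.
move=> [u /andP[ul uh] uE].
have nu : (n < g ^ L)%N by rewrite -uE pal_of_half_lt.
have nl : (g ^ L.-1 <= n)%N by rewrite -uE pal_of_half_ge.
split; last by rewrite subn1 nl nu.
have [a [ag ap nE]] := (palindromic_digitsP L n g0).1
  (ex_intro2 _ _ u uh (esym uE)).
exists L, a; split=> //; split=> // aL.
(* A vanishing leading digit would push [n] below [g ^ L.-1]. *)
move: nl; rewrite nE; case: (L) L0 ag aL => // m _ ag /= aL.
rewrite big_ord_recr /= aL mul0n addn0 leqNgt digit_sum_lt // => k km.
by apply: ag; exact: ltnW.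
Qed.

(** * Cardinalities as sums, and discrepancies *)

Lemma setcard_image (f : nat -> nat) (m n : nat) (T : set nat) :
  {in [pred u | (u < n)%N] &, injective f} ->
  setcard ([set f u | u in [set u | (m <= u < n)%N]] `&` T)
  = (\sum_(m <= u < n) `[< T (f u) >])%N.
Proof.
move=> finj.
pose s := [seq f u | u <- index_iota m n & `[< T (f u) >]].
have us : uniq s.
  rewrite map_inj_in_uniq ?filter_uniq ?iota_uniq // => u v.
  rewrite !mem_filter !mem_index_iota => /andP[_ /andP[_ un]] /andP[_ /andP[_ vn]].
  exact: finj.
have -> : [set f u | u in [set u | (m <= u < n)%N]] `&` T = [set` [fset x in s]%fset].
  apply/seteqP; split=> x /=; rewrite !inE.
    move=> [[u umn <-] Tu]; apply: map_f.
    by rewrite mem_filter mem_index_iota umn andbT; apply/asboolP.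
  move=> /mapP[u]; rewrite mem_filter mem_index_iota => /andP[/asboolP Tu umn] ->.
  by split=> //; exists u.
rewrite /setcard set_fsetK card_imfset //= undup_id // size_map size_filter.
by rewrite -sum1_count big_mkcond.
Qed.

Lemma setcard_image_size (f : nat -> nat) (m n : nat) :
  {in [pred u | (u < n)%N] &, injective f} ->
  setcard [set f u | u in [set u | (m <= u < n)%N]] = (n - m)%N.
Proof.
move=> finj; rewrite -[X in setcard X]setIT setcard_image //.
under eq_bigr do rewrite (asboolT I).
by rewrite sum_nat_const_nat muln1.
Qed.

Lemma setcardUI (S S' T : set nat) : finite_set S -> finite_set S' ->
  S `&` S' = set0 ->
  setcard ((S `|` S') `&` T) = (setcard (S `&` T) + setcard (S' `&` T))%N.
Proof.
move=> fS fS' SS'; rewrite /setcard setIUl fset_setU; try exact: finite_setIl.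
rewrite cardfsU -fset_setI; try exact: finite_setIl.
have -> : S `&` T `&` (S' `&` T) = set0.
  by rewrite -subset0 -SS' => x [[? _] [? _]]; split.
by rewrite fset_set0 cardfs0 subn0.
Qed.

(** Summing over the parameter [u], not over a set of values, makes this additive in the interval
    and applicable to words with leading zeros. *)
Definition discrepancy (R : realType) (q : nat) (f : nat -> nat) (m n : nat)
    (a : int) : R :=
  \sum_(m <= u < n) (((f u)%:Z == a %[mod q%:Z])%Z%:R - q%:R^-1).

Lemma setcard_discrepancy (R : realType) (q m n : nat) (f : nat -> nat) (a : int) :
  (m <= n)%N -> {in [pred u | (u < n)%N] &, injective f} ->
  let S := [set f u | u in [set u | (m <= u < n)%N]] in
  (setcard (S `&` residue_class q a))%:R - (setcard S)%:R / q%:R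
  = discrepancy R q f m n a.
Proof.
move=> mn finj S; rewrite /S setcard_image_size // setcard_image //.
rewrite /discrepancy sumrB sumr_const_nat natr_sum mulr_natl; congr (_ - _).
apply: eq_bigr => u _; congr (_%:R); congr nat_of_bool.
exact/asboolP/eqP.
Qed.

Lemma discrepancy_cat (R : realType) (q : nat) f (m n p : nat) (a : int) :
  (m <= n <= p)%N ->
  discrepancy R q f m p a = discrepancy R q f m n a + discrepancy R q f n p a.
Proof. by move=> /andP[mn np]; rewrite /discrepancy (big_cat_nat mn np). Qed.

Lemma normr_discrepancy (R : realType) (q : nat) f (m n : nat) (a : int) :
  (0 < q)%N -> `|discrepancy R q f m n a| <= (n - m)%:R.
Proof.
move=> q0; apply: le_trans (ler_norm_sum _ _ _) _.
rewrite -[leRHS]mulr_natl mulr1 -sumr_const_nat; apply: ler_sum => u _.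
have qi0 : 0 <= q%:R^-1 :> R by rewrite invr_ge0.
have qi1 : q%:R^-1 <= 1 :> R by rewrite invf_le1 ?ler1n ?ltr0n.
by rewrite ler_norml; case: eqP => _ /=; apply/andP; split; lra.
Qed.

(** * Splitting by the outer digit *)

Lemma sum_blocks (V : nmodType) (F : nat -> V) (G c v : nat) :
  \sum_(0 <= u < c * G + v) F u =
  \sum_(0 <= d < c) \sum_(0 <= w < G) F (d * G + w)%N
  + \sum_(0 <= w < v) F (c * G + w)%N.
Proof.
elim: c v => [|c IH] v; first by rewrite mul0n big_nil add0r.
have -> : (c.+1 * G + v = c * G + (G + v))%N by lia.
rewrite IH big_nat_recr //= -addrA; congr (_ + _).
rewrite (@big_cat_nat _ _ _ G) ?leq_addr //=; congr (_ + _).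
rewrite -{1}[G]add0n big_addn addKn; apply: eq_bigr => w _; congr F; lia.
Qed.

Lemma cong_affine (q g : nat) (r a : int) (b m : nat) : coprime g q ->
  (r * g%:Z = 1 %[mod q%:Z])%Z ->
  ((b + g * m)%N%:Z == a %[mod q%:Z])%Z
  = (m%:Z == r * (a - b%:Z) %[mod q%:Z])%Z.
Proof.
move=> cgq /eqP; rewrite !eqz_mod_dvd => rg.
have cqg : coprimez q g by rewrite /coprimez /gcdz /= gcdnC.
rewrite -(Gauss_dvdzr (m%:Z - _) cqg) PoszD PoszM.
have -> : g%:Z * (m%:Z - r * (a - b%:Z)) =
  (b%:Z + g%:Z * m%:Z - a) - (r * g%:Z - 1) * (a - b%:Z) by ring.
have h : (q%:Z %| (r * g%:Z - 1) * (a - b%:Z))%Z by rewrite dvdz_mulr.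
by rewrite (rpredBr _ h).
Qed.

(** With outer digit [d] the word is [d * (g ^ L.+1 + 1)] plus [g] times a word of length [L];
    inverting [g] modulo [q] turns the class [a] into a class [b d] for the shorter words. Since [v]
    may be a full block, [c = 0] covers all words with outer digit zero. *)
Lemma discrepancy_pal_split (R : realType) (q g L : nat) (a : int) :
  (0 < g)%N -> coprime g q ->
  exists b : nat -> int, forall c v, (v <= g ^ uphalf L)%N ->
    discrepancy R q (pal_of_half g L.+2) 0 (c * g ^ uphalf L + v) a =
    \sum_(0 <= d < c)
       discrepancy R q (pal_of_half g L) 0 (g ^ uphalf L) (b d)
    + discrepancy R q (pal_of_half g L) 0 v (b c).
Proof.
move=> g0 cgq; set G := (g ^ uphalf L)%N.
have G0 : (0 < G)%N by rewrite expn_gt0 g0.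
have cgqz : coprimez g q by [].
have [[r s] /= rs] := coprimezP _ _ cgqz.
have rg : (r * g%:Z = 1 %[mod q%:Z])%Z.
  by apply/eqP; rewrite eqz_mod_dvd -rs opprD addrA subrr add0r rpredN dvdz_mull.
exists (fun d => r * (a - (d * (g ^ L.+1 + 1))%N%:Z)) => c v vG.
have E d w : (w < G)%N ->
    ((pal_of_half g L.+2 (d * G + w))%:Z == a %[mod q%:Z])%Z =
    ((pal_of_half g L w)%:Z == r * (a - (d * (g ^ L.+1 + 1))%N%:Z) %[mod q%:Z])%Z.
  move=> wG; rewrite pal_of_halfSS -/G divnMDl // divn_small // addn0.
  by rewrite modnMDl modn_small // (cong_affine _ _ _ cgq rg).
rewrite /discrepancy sum_blocks; congr (_ + _).
  by apply: eq_bigr => d _; apply: eq_big_nat => w /andP[_ wG]; rewrite E.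
by apply: eq_big_nat => w /andP[_ wv]; rewrite E // (leq_trans wv).
Qed.

(** * Invertibility of [g] modulo [q] *)

Lemma expr_lt_eps (R : realType) (z e : R) : 0 <= z -> z < 1 -> 0 < e ->
  exists n, z ^+ n < e.
Proof.
move=> z0 z1 e0.
have z1' : `|z| < 1 by rewrite ger0_norm.
have /cvgrPdist_lt /(_ _ e0) [N _ /(_ N (leqnn N))] := cvg_expr z1'.
by rewrite sub0r normrN ger0_norm ?exprn_ge0 //; exists N.
Qed.

(** Only the residue of [n] contributes, and as [d] divides [q] it is a multiple of [d] exactly when
    [n] is. *)
Lemma sum_dvd_cong (R : realType) (q d n : nat) : (0 < q)%N -> (d %| q)%N ->
  \sum_(0 <= a < q | (d %| a)%N) ((n%:Z == a%:Z %[mod q%:Z])%Z%:R : R)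
  = (d %| n)%N%:R.
Proof.
move=> q0 dq; rewrite big_mkcond /= big_mkord (bigD1 (Ordinal (ltn_pmod n q0))) //=.
rewrite big1 ?addr0 => [|[i iq] /= ni].
  rewrite !modz_nat modn_mod eqxx.
  have -> : (d %| n %% q)%N = (d %| n)%N.
    by rewrite {2}(divn_eq n q) dvdn_addr // dvdn_mull.
  by case: ifP.
case: ifP => // _; rewrite !modz_nat (modn_small iq) eqz_nat.
by move: ni; rewrite -val_eqE /= eq_sym => /negbTE ->.
Qed.

Lemma sum_dvd_range (d n : nat) : (0 < d)%N -> (d %| n)%N -> (0 < n)%N ->
  (\sum_(1 <= c < n) (d %| c) = (n %/ d).-1)%N.
Proof.
move=> d0 /dvdnP[m ->]; rewrite muln_gt0 => /andP[m0 _].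
rewrite mulnK // -{1}(prednK (_ : 0 < m * d)%N) ?muln_gt0 ?m0 // -divn_count_dvd.
have -> : ((m * d).-1 = m.-1 * d + d.-1)%N by case: m m0 => // m _; lia.
by rewrite divnMDl // divn_small ?addn0 // prednK.
Qed.

(** Modulo [d] only the last digit survives, and by symmetry it equals the outer digit of [u]. *)
Lemma pal_of_half_dvd (g L u d : nat) : (d %| g)%N ->
  (d %| pal_of_half g L.+2 u)%N = (d %| u %/ g ^ uphalf L)%N.
Proof.
move=> dg; rewrite pal_of_halfSS (dvdn_addl _ (dvdn_mulr _ dg)).
by rewrite mulnDr muln1 dvdn_addr // dvdn_mull // expnS dvdn_mulr.
Qed.

(** Each outer digit from [1] to [g - 1] occurs [g ^ uphalf L] times. Among these digits [g / d - 1]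
    are multiples of [d], against [(g - 1) / d] expected; the difference is [1 / d - 1]. *)
Lemma discrepancy_pal_dvd (R : realType) (g q L d : nat) :
  (1 < g)%N -> (0 < q)%N -> (0 < d)%N -> (d %| g)%N -> (d %| q)%N ->
  \sum_(0 <= a < q | (d %| a)%N)
    discrepancy R q (pal_of_half g L.+2) (g ^ uphalf L) (g ^ (uphalf L).+1) a%:Z
  = (g ^ uphalf L)%:R * (d%:R^-1 - 1).
Proof.
move=> g1 q0 d0 dg dq; set G := (g ^ uphalf L)%N.
have G0 : (0 < G)%N by rewrite expn_gt0 ltnW.
have qn0 : q%:R != 0 :> R by rewrite pnatr_eq0 -lt0n.
have dn0 : d%:R != 0 :> R by rewrite pnatr_eq0 -lt0n.
rewrite /discrepancy exchange_big.
have E u : \sum_(0 <= a < q | (d %| a)%N)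
    (((pal_of_half g L.+2 u)%:Z == a%:Z %[mod q%:Z])%Z%:R - q%:R^-1) =
    (d %| u %/ G)%N%:R - d%:R^-1 :> R.
  rewrite sumrB sum_dvd_cong // pal_of_half_dvd //; congr (_ - _).
  (* The term [a = 0] is added to the [q / d - 1] positive multiples of [d]. *)
  rewrite big_mkcond big_ltn //= dvdn0.
  under eq_bigr do rewrite -mulrb -[_ *+ nat_of_bool _]mulr_natr.
  rewrite -mulr_sumr -natr_sum sum_dvd_range // -[X in X + _]mulr1 -mulrDr nat1r.
  rewrite prednK; last by rewrite divn_gt0 //; exact: dvdn_leq.
  case/dvdnP: dq qn0 => m ->; rewrite mulnK // natrM mulf_eq0 negb_or => /andP[mn0 _].
  by field; rewrite dn0 mn0.
under eq_bigr do rewrite E.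
(* The range consists of [g - 1] blocks of length [G]; after the shift by [G], block [c] has outer
   digit [c.+1]. *)
have -> : (g ^ (uphalf L).+1 = G + (g.-1 * G + 0))%N.
  by rewrite expnS -/G -[in LHS](prednK (ltnW g1)); lia.
rewrite -{1}[G]add0n big_addn addKn sum_blocks big_nil addr0.
rewrite (eq_bigr (fun c => G%:R * ((d %| c.+1)%N%:R - d%:R^-1))); last first.
  move=> c _; rewrite (eq_big_nat _ _ (F2 := fun=> (d %| c.+1)%N%:R - d%:R^-1)).
    by rewrite sumr_const_nat subn0 mulr_natl.
  move=> w /andP[_ wG].
  by rewrite (_ : (c * G + w + G = c.+1 * G + w)%N) ?divnMDl ?divn_small ?addn0 //; lia.
rewrite -mulr_sumr sumrB sumr_const_nat subn0; congr (_ * _).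
have := sum_dvd_range d0 dg (ltnW g1).
rewrite big_add1 -natr_sum => ->.
case/dvdnP: dg g1 => m -> md; rewrite mulnK //.
have m0 : (0 < m)%N by case: m md.
rewrite -!subn1 -[_^-1 *+ _]mulr_natr !natrB ?natrM; [by field|lia|lia].
Qed.

(** The number of palindromic words of length [L] times the relative error [xi ^ L]: the unit in
    which errors are measured. *)
Definition pal_scale (R : realType) (g : nat) (xi : R) (L : nat) : R :=
  g%:R ^+ uphalf L * xi ^+ L.

(** Starting [u] at [g ^ (uphalf L).-1] excludes a zero leading digit. This is the hypothesis of the
    theorem with the cardinality on the right enlarged to [g ^ uphalf L]. *)
Definition pal_equidistributed (R : realType) (g q : nat) (A xi : R) : Prop :=
  forall L a, (0 < L)%N ->
    `|discrepancy R q (pal_of_half g L) (g ^ (uphalf L).-1) (g ^ uphalf L) a|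
    <= A * pal_scale g xi L.

(* If [d = gcdn g q > 1], the last digit, which is never zero, decides
   divisibility by [d]; so multiples of [d] are underrepresented by a fixed
   proportion in every length. *)
Lemma pal_equidistributed_coprime (R : realType) (g q : nat) (A xi : R) :
  (1 < g)%N -> (0 < q)%N -> 0 <= A -> 0 <= xi -> xi < 1 ->
  pal_equidistributed g q A xi -> coprime g q.
Proof.
move=> g1 q0 A0 xi0 xi1 H; rewrite /coprime; set d := gcdn g q.
have d0 : (0 < d)%N by rewrite gcdn_gt0 q0 orbT.
have dg : (d %| g)%N := dvdn_gcdl g q.
have dq : (d %| q)%N := dvdn_gcdr g q.
case: (ltngtP d 1) => [|d1|//]; first by rewrite ltnS leqNgt d0.
have C0 : 0 < q%:R * A * g%:R + 1 :> R by rewrite ltr_wpDl // !mulr_ge0.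
have e0 : 0 < (2 * (q%:R * A * g%:R + 1))^-1 :> R by rewrite invr_gt0 mulr_gt0.
(* Relative to [g ^ uphalf L], the bias [1 - 1 / d] is at least [1 / 2], while at most [q] residues
   err together by at most [q * A * g * xi ^ L]; this [L] makes that less than [1 / 2]. *)
have [L xiL] := expr_lt_eps xi0 xi1 e0.
have G0 : 0 < (g ^ uphalf L)%:R :> R by rewrite ltr0n expn_gt0 ltnW.
have := discrepancy_pal_dvd R L g1 q0 d0 dg dq.
move=> /(congr1 Num.norm); rewrite normrM (ger0_norm (ltW G0)).
have di : d%:R^-1 <= 2^-1 :> R by rewrite lef_pV2 ?posrE ?ltr0n // ler_nat.
rewrite ler0_norm; last lra.
move=> E; have {E} : (g ^ uphalf L)%:R * - (d%:R^-1 - 1) <=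
    q%:R * (A * pal_scale g xi L.+2).
  rewrite -E; apply: le_trans (ler_norm_sum _ _ _) _.
  rewrite big_mkcond /= -[q in leRHS]subn0 mulr_natl -sumr_const_nat.
  apply: ler_sum => a _; case: ifP => _; first exact: (H L.+2 _ isT).
  by rewrite mulr_ge0 // mulr_ge0 // exprn_ge0.
rewrite /pal_scale /= exprS natrX => E.
have G0' : 0 < g%:R ^+ uphalf L :> R by rewrite -natrX.
have {E} : - (d%:R^-1 - 1) <= q%:R * A * g%:R * xi ^+ L.+2.
  by rewrite -(ler_pM2l G0') (le_trans E) // le_eqVlt; apply/orP; left; apply/eqP; ring.
have xi2 : xi ^+ L.+2 <= xi ^+ L by rewrite ler_wiXn2l // ?ltW //; lia.
have xiL0 : 0 <= xi ^+ L by rewrite exprn_ge0.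
have : (q%:R * A * g%:R + 1) * xi ^+ L < 2^-1.
  by rewrite -ltr_pdivlMl // -invfM mulrC.
have : q%:R * A * g%:R * xi ^+ L.+2 <= q%:R * A * g%:R * xi ^+ L.
  by rewrite ler_wpM2l // !mulr_ge0.
lra.
Qed.

(** * Geometric growth of the scale *)

Lemma pal_scale_gt0 (R : realType) (g : nat) (xi : R) (L : nat) :
  (1 < g)%N -> 0 < xi -> 0 < pal_scale g xi L.
Proof. by move=> g1 xi0; rewrite mulr_gt0 // exprn_gt0 // ltr0n ltnW. Qed.

(** Two more digits multiply the scale by [g * xi ^ 2 >= 2 * (2 / 3) = 4 / 3]. *)
Lemma pal_scale_leSS (R : realType) (g : nat) (xi : R) (L : nat) :
  (1 < g)%N -> 0 < xi -> 2 / 3 <= xi ^+ 2 ->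
  pal_scale g xi L <= 3 / 4 * pal_scale g xi L.+2.
Proof.
move=> g1 xi0 xi2.
have -> : pal_scale g xi L.+2 = g%:R * xi ^+ 2 * pal_scale g xi L.
  by rewrite /pal_scale /= !exprS; ring.
have s0 := pal_scale_gt0 L g1 xi0; rewrite mulrA -[leLHS]mul1r.
apply: (ler_wpM2r (ltW s0)).
have : 2 * (2 / 3) <= g%:R * xi ^+ 2 by rewrite ler_pM ?ler_nat //; lra.
lra.
Qed.

(** From odd to even length the power of [g] does not grow, so only [xi >= xi ^ 2 >= 2 / 3] is
    available. *)
Lemma pal_scale_leS (R : realType) (g : nat) (xi : R) (L : nat) :
  (1 < g)%N -> 0 < xi -> xi < 1 -> 2 / 3 <= xi ^+ 2 ->
  pal_scale g xi L <= 3 / 2 * pal_scale g xi L.+1.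
Proof.
move=> g1 xi0 xi1 xi2; rewrite /pal_scale exprS.
have gL : g%:R ^+ uphalf L <= g%:R ^+ uphalf L.+1 :> R.
  by rewrite ler_weXn2l ?ler1n ?uphalf_leq // ltnW.
have G0 : 0 <= g%:R ^+ uphalf L :> R by rewrite exprn_ge0.
have X0 : 0 <= xi ^+ L by rewrite exprn_ge0 // ltW.
have xi23 : 2 / 3 <= xi by move: xi2; rewrite expr2; nra.
rewrite [leRHS](_ : _ = 3 / 2 * xi * (g%:R ^+ uphalf L.+1 * xi ^+ L)); last ring.
have : g%:R ^+ uphalf L * xi ^+ L <= g%:R ^+ uphalf L.+1 * xi ^+ L.
  by rewrite ler_wpM2r.
have : 0 <= g%:R ^+ uphalf L.+1 * xi ^+ L by rewrite mulr_ge0 // exprn_ge0.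
by move: (_ * _) (_ * _) => s s'; nra.
Qed.

(** The constant solves [(9 + 1) * 3 / 4 + 3 / 2 = 9]: two steps add the scales of [L] and [L.+1] to
    the sum. *)
Lemma sum_pal_scale (R : realType) (g : nat) (xi : R) (L : nat) :
  (1 < g)%N -> 0 < xi -> xi < 1 -> 2 / 3 <= xi ^+ 2 ->
  \sum_(0 <= l < L) pal_scale g xi l <= 9 * pal_scale g xi L.
Proof.
move=> g1 xi0 xi1 xi2; elim/nat_ind_step2: L => [||L IH].
- by rewrite big_nil mulr_ge0 // ltW // pal_scale_gt0.
- rewrite big_nat1; have := pal_scale_leS 0 g1 xi0 xi1 xi2.
  by have := pal_scale_gt0 1 g1 xi0; lra.
rewrite !big_nat_recr //=.
have := pal_scale_leSS L g1 xi0 xi2; have := pal_scale_leS L.+1 g1 xi0 xi1 xi2.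
lra.
Qed.

(** This absorbs the trivial bounds used for words of length one. *)
Lemma pal_scale1_ge1 (R : realType) (g : nat) (xi : R) :
  (1 < g)%N -> 0 < xi -> xi < 1 -> 2 / 3 <= xi ^+ 2 -> 1 <= pal_scale g xi 1.
Proof.
move=> g1 xi0 xi1; rewrite /pal_scale !expr1 expr2 => xi2.
have g2 : 2 <= g%:R :> R by rewrite ler_nat.
nra.
Qed.

(** * Discrepancy of palindromic words *)

(* A palindromic word of length [L.+2] is a palindrome of that length or, when
   its outer digits vanish, [g] times a palindromic word of length [L]. *)
Lemma discrepancy_pal_full (R : realType) (g q : nat) (A xi : R) (L : nat) (a : int) :
  (1 < g)%N -> (0 < q)%N -> 1 <= A ->
  0 < xi -> xi < 1 -> 2 / 3 <= xi ^+ 2 -> pal_equidistributed g q A xi ->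
  `|discrepancy R q (pal_of_half g L) 0 (g ^ uphalf L) a|
  <= 4 * A * pal_scale g xi L.
Proof.
move=> g1 q0 A1 xi0 xi1 xi2 eqd.
have cgq : coprime g q.
  by apply: pal_equidistributed_coprime eqd => //; lra.
elim/nat_ind_step2: L a => [a|a|L IH a].
- apply: le_trans (normr_discrepancy _ _ _ _ _ q0) _.
  by rewrite /pal_scale /= !expr0 subn0 expn0; lra.
- rewrite (@discrepancy_cat _ _ _ _ 1%N) ?expn1 ?(ltnW g1) //.
  apply: le_trans (ler_normD _ _) _.
  have := eqd _ a (isT : (0 < 1)%N); rewrite /= expn0 expn1.
  have := normr_discrepancy R (pal_of_half g 1) 0 1 a q0; rewrite subn0.
  by have := pal_scale1_ge1 g1 xi0 xi1 xi2; nra.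
have GG : (g ^ uphalf L <= g ^ uphalf L.+2)%N by rewrite leq_exp2l //= leqnSn.
rewrite (@discrepancy_cat _ _ _ _ (g ^ uphalf L)) ?GG //.
apply: le_trans (ler_normD _ _) _.
have [b bE] := discrepancy_pal_split R L a (ltnW g1) cgq.
(* The single block with outer digit zero. *)
have := bE 0%N _ (leqnn _); rewrite mul0n add0n big_nil add0r => ->.
have := IH (b 0%N); have := eqd _ a (isT : (0 < L.+2)%N).
have := pal_scale_leSS L g1 xi0 xi2; move: (discrepancy _ _ _ _ _ _) => D1.
move: (discrepancy _ _ _ _ _ _) => D2 /=.
(* In units of [A * pal_scale g xi L.+2], the shorter words contribute [4 * 3 / 4 = 3] and the
   palindromes of full length [1]. *)
by move: (pal_scale _ _ _) (pal_scale _ _ _) => s s'; nra.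
Qed.

(* Below [V], split on the outer digit: at most [g] complete blocks of words of
   length [L], and one incomplete block handled by induction. *)
Lemma discrepancy_pal_initial (R : realType) (g q : nat) (A xi : R) (L V : nat) (a : int) :
  (1 < g)%N -> (0 < q)%N -> 1 <= A ->
  0 < xi -> xi < 1 -> 2 / 3 <= xi ^+ 2 -> pal_equidistributed g q A xi ->
  (V <= g ^ uphalf L)%N ->
  `|discrepancy R q (pal_of_half g L) 0 V a|
  <= 12 * g%:R * A * pal_scale g xi L.
Proof.
move=> g1 q0 A1 xi0 xi1 xi2 eqd.
have cgq : coprime g q.
  by apply: pal_equidistributed_coprime eqd => //; lra.
have g2 : 2 <= g%:R :> R by rewrite ler_nat.
have gA : g%:R <= g%:R * A by rewrite ler_peMr.
elim/nat_ind_step2: L V a => [V a V1|V a Vg|L IH V a VG].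
- apply: le_trans (normr_discrepancy _ _ _ _ _ q0) _.
  rewrite /pal_scale /= !expr0 subn0.
  have : V%:R <= 1 :> R by rewrite lern1.
  by lra.
- apply: le_trans (normr_discrepancy _ _ _ _ _ q0) _; rewrite subn0.
  have : V%:R <= g%:R :> R by rewrite ler_nat -(expn1 g).
  by have := pal_scale1_ge1 g1 xi0 xi1 xi2; nra.
set G := (g ^ uphalf L)%N.
have G0 : (0 < G)%N by rewrite expn_gt0 ltnW.
have [b bE] := discrepancy_pal_split R L a (ltnW g1) cgq.
rewrite (divn_eq V G) bE; last by rewrite ltnW // ltn_mod.
have cg : (V %/ G <= g)%N by rewrite -(mulnK g G0) leq_div2r // -expnS.
apply: le_trans (ler_normD _ _) _.
have := IH _ (b (V %/ G)%N) (ltnW (ltn_pmod V G0)).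
have : `|\sum_(0 <= d < V %/ G)
          discrepancy R q (pal_of_half g L) 0 G (b d)|
       <= g%:R * (4 * A * pal_scale g xi L).
  apply: le_trans (ler_norm_sum _ _ _) _.
  apply: (@le_trans _ _ (\sum_(0 <= d < V %/ G) 4 * A * pal_scale g xi L)).
    by apply: ler_sum => d _; exact: discrepancy_pal_full.
  rewrite sumr_const_nat subn0 -[_ *+ (V %/ G)]mulr_natl ler_wpM2r ?ler_nat //.
  by rewrite mulr_ge0 ?ltW ?pal_scale_gt0 //; lra.
have := pal_scale_leSS L g1 xi0 xi2.
move: `|_| `|_| (pal_scale _ _ _) (pal_scale _ _ _) => n1 n2 s s' ss h1 h2.
(* At most [g] complete blocks at [4] each and the incomplete one at [12 * g] give [16 * g]; the
   factor [3 / 4] of the scale brings this back to [12 * g]. *)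
have -> : 12 * g%:R * A * s = 16 * (g%:R * A) * (3 / 4 * s) by field.
by nra.
Qed.

Lemma discrepancy_pal_interval (R : realType) (g q : nat) (A xi : R) (L m n : nat) (a : int) :
  (1 < g)%N -> (0 < q)%N -> 1 <= A ->
  0 < xi -> xi < 1 -> 2 / 3 <= xi ^+ 2 -> pal_equidistributed g q A xi ->
  (m <= n <= g ^ uphalf L)%N ->
  `|discrepancy R q (pal_of_half g L) m n a|
  <= 24 * g%:R * A * pal_scale g xi L.
Proof.
move=> g1 q0 A1 xi0 xi1 xi2 eqd /andP[mn nG].
have := discrepancy_pal_initial a g1 q0 A1 xi0 xi1 xi2 eqd nG.
have := discrepancy_pal_initial a g1 q0 A1 xi0 xi1 xi2 eqd (leq_trans mn nG).
rewrite (@discrepancy_cat _ _ _ 0 m n) // !ler_norml => /andP[? ?] /andP[? ?].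
by apply/andP; split; lra.
Qed.

(** * Palindromes up to a bound *)

Lemma palindromes_gt0 (g n : nat) : (0 < g)%N -> palindromes g n -> (0 < n)%N.
Proof.
move=> g0 [L [a [[L0 _ /eqP aL ->] _]]]; case: L L0 aL => // L _ /= aL.
by rewrite big_ord_recr /= addn_gt0 muln_gt0 [(0 < a L)%N]lt0n aL expn_gt0 g0 orbT.
Qed.

Lemma finite_palindromes_below (g N : nat) :
  finite_set [set n | palindromes g n /\ (n < N)%N].
Proof. by apply: (@sub_finite_set _ _ `I_N) (finite_II _) => n []. Qed.

Lemma setcard_palindromes_below (g t : nat) (T : set nat) : (1 < g)%N ->
  setcard ([set n | palindromes g n /\ (n < g ^ t)%N] `&` T)
  = (\sum_(1 <= l < t.+1) setcard (palindromes_len g l `&` T))%N.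
Proof.
move=> g1; elim: t => [|t IH].
  (* Zero is not a palindrome, so nothing lies below [g ^ 0]. *)
  rewrite big_nil (_ : _ `&` _ = set0) ?/setcard ?fset_set0 ?cardfs0 //.
  by rewrite -subset0 => n [[/(palindromes_gt0 (ltnW g1)) + +] _]; rewrite expn0; lia.
rewrite big_nat_recr //= -IH -setcardUI.
- congr (setcard (_ `&` _)); apply/seteqP; split=> n /=.
    move=> [np nt]; case: (ltnP n (g ^ t)) => h; [by left|right].
    by split=> //; rewrite subn1 h.
  move=> [[np nt]|[np /andP[_ nt]]]; split=> //.
  by rewrite (leq_trans nt) // leq_exp2l.
- exact: finite_palindromes_below.
- exact: finite_palindromes_len.
by rewrite -subset0 => n [[_ nt] [_]]; rewrite subn1 leqNgt nt.
Qed.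

Lemma downclosed_threshold (p : pred nat) (n : nat) :
  (forall u v, (u <= v)%N -> (v < n)%N -> p v -> p u) ->
  exists2 V, (V <= n)%N & forall u, (u < n)%N -> p u = (u < V)%N.
Proof.
elim: n => [|n IH] pd; first by exists 0%N.
have [pn|pn] := boolP (p n).
  by exists n.+1 => // u un; rewrite un (pd u n).
have [|V Vn VE] := IH; first by move=> u v uv vn; apply: pd => //; exact: ltnW.
exists V => [|u]; first exact: ltnW.
rewrite ltnS leq_eqVlt => /predU1P[->|/VE //].
by rewrite (negbTE pn) ltnNge Vn.
Qed.

(* A palindrome is monotone in its upper half, so a cutoff at [y] is a cutoff
   [V] on the upper half. *)
Lemma palindromes_len_le (g L y : nat) : (1 < g)%N -> (0 < L)%N ->
  (g ^ L.-1 <= y)%N ->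
  exists2 V, (g ^ (uphalf L).-1 <= V <= g ^ uphalf L)%N /\
             (L = 1%N -> (1 < V)%N) &
    palindromes_len g L `&` [set n | (n <= y)%N] =
    [set pal_of_half g L u | u in [set u | (g ^ (uphalf L).-1 <= u < V)%N]].
Proof.
move=> g1 L0 yL.
have g0 := ltnW g1.
have [u v uv vh|V Vh VE] := @downclosed_threshold
    (fun u => pal_of_half g L u <= y)%N (g ^ uphalf L).
  move: uv; rewrite leq_eqVlt => /predU1P[-> //|uv]; apply: leq_trans.
  exact/ltnW/pal_of_half_mono.
have mh : (g ^ (uphalf L).-1 <= g ^ uphalf L)%N by rewrite leq_exp2l // leq_pred.
(* The maximum secures the lower bound on the cutoff without changing the set cut out. *)
exists (maxn V (g ^ (uphalf L).-1)).
  split; first by rewrite leq_maxr geq_max Vh.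
  (* For one digit, [1 <= y] puts [u = 1] below the cutoff; this keeps the count up to [x] positive
     when [x < g]. *)
  move=> L1; move: VE yL; rewrite L1 /= expn1 => /(_ _ g1) + y1.
  by rewrite leq_max -[1%N](expn0 g) y1 => <-.
rewrite palindromes_lenE //; apply/seteqP; split=> n /=.
  move=> [[u /andP[mu uh] <-] ny]; exists u => //.
  by rewrite mu leq_max -VE // ny.
move=> [u /andP[mu]]; rewrite leq_max orbC ltnNge mu /= => uV <-.
have uh := leq_trans uV Vh.
by split; [exists u => //; rewrite mu|rewrite VE].
Qed.

Lemma setcard_palindromes_len (g L : nat) : (1 < g)%N -> (0 < L)%N ->
  setcard (palindromes_len g L) = (g ^ uphalf L - g ^ (uphalf L).-1)%N.
Proof.
move=> g1 L0; rewrite palindromes_lenE // setcard_image_size //.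
exact/pal_of_half_inj/ltnW.
Qed.

Lemma palindromes_len_discrepancy (R : realType) (g q L : nat) (a : int) :
  (1 < g)%N -> (0 < L)%N ->
  (setcard (palindromes_len g L `&` residue_class q a))%:R
    - (setcard (palindromes_len g L))%:R / q%:R
  = discrepancy R q (pal_of_half g L) (g ^ (uphalf L).-1) (g ^ uphalf L) a.
Proof.
move=> g1 L0; rewrite palindromes_lenE // setcard_discrepancy //.
  by rewrite leq_exp2l // leq_pred.
exact/pal_of_half_inj/ltnW.
Qed.

Lemma setcard_palindromes_upto (R : realType) (g t : nat) (x : R) (T : set nat) :
  (1 < g)%N -> (g ^ t <= Num.truncn x < g ^ t.+1)%N ->
  setcard (palindromes_upto g x `&` T) =
  (\sum_(1 <= l < t.+1) setcard (palindromes_len g l `&` T)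
   + setcard (palindromes_len g t.+1 `&` [set n | (n <= Num.truncn x)%N] `&` T))%N.
Proof.
move=> g1 /andP[tx xt].
have x0 : 0 <= x.
  by apply/ltW/(lt_le_trans ltr01); rewrite -truncn_gt0 (leq_trans _ tx) // expn_gt0 ltnW.
rewrite -setcard_palindromes_below // -setcardUI.
- congr (setcard (_ `&` _)); apply/seteqP; split=> n /=.
    move=> [np]; rewrite -truncn_ge_nat // => nx.
    case: (ltnP n (g ^ t)) => h; [by left|right].
    by split=> //; split=> //; rewrite subn1 h (leq_ltn_trans nx).
  rewrite /palindromes_upto /= -truncn_ge_nat //.
  by move=> [[np nt]|[[np _] nx]]; split=> //; rewrite ltnW // (leq_trans nt).
- exact: finite_palindromes_below.
- exact/finite_setIl/finite_palindromes_len.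
by rewrite -subset0 => n [[_ nt] [[_]]]; rewrite subn1 leqNgt nt.
Qed.

(** For [t > 0] all palindromes of length [t] are counted, at least [g ^ (uphalf t).-1] of them. One
    factor [g] pays for the restricted leading digit, the other for a possible extra digit in the
    half. For [t = 0] the palindrome [1] suffices. *)
Lemma setcard_palindromes_upto_ge (R : realType) (g t : nat) (x : R) :
  (1 < g)%N -> (g ^ t <= Num.truncn x < g ^ t.+1)%N ->
  (g ^ uphalf t.+1 <= g ^ 2 * setcard (palindromes_upto g x))%N.
Proof.
move=> g1 tx; have g0 := ltnW g1.
rewrite -[palindromes_upto g x]setIT (setcard_palindromes_upto _ g1 tx) !setIT.
case: t tx => [|t] tx.
  have /andP[tx1 _] := tx.
  have [V [_ V1] ->] := palindromes_len_le g1 (isT : (0 < 1)%N) tx1.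
  rewrite big_nil add0n setcard_image_size => [|u v /= _ _ //].
  by move: (V1 erefl) => /= {}V1; rewrite !expnS !expn0 !muln1; nia.
rewrite big_nat_recr //= setIT setcard_palindromes_len //=.
have le : (g ^ (uphalf t).+1 <= g ^ 2 * g ^ t./2)%N.
  by rewrite -expnD leq_exp2l // uphalf_half; lia.
apply: leq_trans le _; rewrite leq_mul2l; apply/orP; right.
rewrite expnS; apply: leq_trans (leq_addr _ _); apply: leq_trans (leq_addl _ _).
by rewrite -[X in (_ - X)%N]mul1n -mulnBl leq_pmull // subn_gt0.
Qed.

(** * Summation over all lengths *)

Theorem theorem4p3 (R : realType) (g : nat) (hg : (2 <= g)%N) :
  exists2 B : R, 1 <= B &
    forall (q : nat) (A xi : R),
      (2 <= q)%N -> 1 <= A -> Num.sqrt (2 / 3) <= xi -> xi < 1 ->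
      (forall (L : nat) (a : int), (1 <= L)%N ->
        `|(setcard (palindromes_len g L `&` residue_class q a))%:R
            - (setcard (palindromes_len g L))%:R / q%:R|
          <= (setcard (palindromes_len g L))%:R * (A * xi ^+ L)) ->
      forall (x : R) (a : int), 1 <= x ->
        `|(setcard (palindromes_upto g x `&` residue_class q a))%:R
            - (setcard (palindromes_upto g x))%:R / q%:R|
          <= (setcard (palindromes_upto g x))%:R
               * (A * B * xi `^ (ln x / (2 * ln g%:R))).
Proof.
have g2 : 2 <= g%:R :> R by rewrite ler_nat.
(* Here [9] comes from the complete lengths, [24 * g] from the top length cut at [x], and [g ^ 2]
   from bounding [g ^ uphalf t.+1] by the count up to [x]. *)
exists ((9 + 24 * g%:R) * g%:R ^+ 2); first by nra.
move=> q A xi q2 A1 sxi xi1 H x a x1.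
have q0 := ltnW q2.
have xi0 : 0 < xi by apply: lt_le_trans sxi; rewrite sqrtr_gt0; lra.
have xi2 : 2 / 3 <= xi ^+ 2.
  rewrite -[2 / 3](@sqr_sqrtr R) ?ler_sqr ?nnegrE ?sqrtr_ge0 ?(ltW xi0) //; lra.
have eqd : pal_equidistributed g q A xi.
  move=> L b L0; rewrite -palindromes_len_discrepancy //.
  apply: le_trans (H L b L0) _; rewrite setcard_palindromes_len //.
  rewrite /pal_scale [leRHS]mulrCA ler_wpM2r ?mulr_ge0 ?exprn_ge0 //; try lra.
  by rewrite -natrX ler_nat leq_subr.
have y0 : (0 < Num.truncn x)%N by rewrite truncn_gt0.
(* The integer part of [x] has [t.+1] digits. *)
have tx := trunc_log_bounds hg y0; move: (trunc_log g _) tx => t tx.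
have /andP[tx1 tx2] := tx.
have [V [/andP[V1 V2] _] VE] := palindromes_len_le hg (isT : (0 < t.+1)%N) tx1.
set N := (setcard (palindromes_upto g x))%:R : R.
have NE : g%:R ^+ uphalf t.+1 <= g%:R ^+ 2 * N.
  by rewrite -!natrX -natrM ler_nat setcard_palindromes_upto_ge.
have E1 : `|(setcard (palindromes_upto g x `&` residue_class q a))%:R - N / q%:R|
    <= A * ((9 + 24 * g%:R) * pal_scale g xi t.+1).
  have -> : N = (\sum_(1 <= l < t.+1) setcard (palindromes_len g l) +
      setcard (palindromes_len g t.+1 `&` [set n | (n <= Num.truncn x)%N]))%N%:R.
    rewrite /N -[palindromes_upto g x]setIT (setcard_palindromes_upto _ hg tx) setIT.
    by under eq_bigr do rewrite setIT.
  rewrite (setcard_palindromes_upto _ hg tx) VE !natrD !natr_sum mulrDl opprD.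
  rewrite addrACA mulr_suml -sumrB setcard_discrepancy //; last first.
    move=> u v; rewrite !inE => uV vV.
    by apply: (pal_of_half_inj (ltnW hg)); rewrite inE (leq_trans _ V2).
  rewrite (eq_big_nat _ _ (F2 := fun l => discrepancy R q (pal_of_half g l)
       (g ^ (uphalf l).-1) (g ^ uphalf l) a)); last first.
    by move=> l /andP[l0 _]; exact: palindromes_len_discrepancy.
  apply: le_trans (ler_normD _ _) _.
  have -> : A * ((9 + 24 * g%:R) * pal_scale g xi t.+1) =
    A * (9 * pal_scale g xi t.+1) + 24 * g%:R * A * pal_scale g xi t.+1 by ring.
  apply: lerD; last by apply: discrepancy_pal_interval => //; rewrite V1.
  apply: le_trans (ler_norm_sum _ _ _) _.
  (* Adding the nonnegative term [l = 0] matches the range of [sum_pal_scale]. *)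
  apply: (@le_trans _ _ (A * \sum_(0 <= l < t.+1) pal_scale g xi l)).
    rewrite [in leRHS]big_ltn // mulrDr mulr_sumr -[leLHS]add0r lerD //.
      by rewrite mulr_ge0 ?ltW ?pal_scale_gt0 //; lra.
    rewrite !big_nat; apply: ler_sum => l /andP[l0 _]; exact: eqd.
  by rewrite ler_wpM2l ?sum_pal_scale //; lra.
apply: le_trans E1 _.
(* As [x < g ^ t.+1], the exponent on the right is at most [t.+1], and powers of [xi < 1] decrease
   in the exponent. *)
have xiE : xi ^+ t.+1 <= xi `^ (ln x / (2 * ln g%:R)).
  have lng : 0 < ln (g%:R : R) by rewrite ln_gt0 // ltr1n.
  rewrite -(powR_mulrn _ (ltW xi0)) ger_powR ?xi0 ?(ltW xi1) //.
  rewrite ler_pdivrMr ?mulr_gt0 //.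
  have xg : x <= g%:R ^+ t.+1.
    by rewrite -natrX; apply/ltW; rewrite -truncn_lt_nat //; lra.
  have lx : ln x <= ln (g%:R ^+ t.+1 : R).
    by rewrite ler_ln ?posrE ?exprn_gt0 //; lra.
  have g0 : 0 < g%:R :> R by lra.
  rewrite lnXn // in lx; apply: le_trans lx _; rewrite -[leLHS]mulr_natl.
  rewrite ler_wpM2l ?ler0n //; lra.
have N0 : 0 <= N by rewrite ler0n.
rewrite /pal_scale.
have xiL0 : 0 <= xi ^+ t.+1 by rewrite exprn_ge0 // ltW.
have le : g%:R ^+ uphalf t.+1 * xi ^+ t.+1 <=
    g%:R ^+ 2 * N * xi `^ (ln x / (2 * ln g%:R)).
  by rewrite ler_pM // exprn_ge0.
have -> : N * (A * ((9 + 24 * g%:R) * g%:R ^+ 2) * xi `^ (ln x / (2 * ln g%:R))) =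
  A * ((9 + 24 * g%:R) * (g%:R ^+ 2 * N * xi `^ (ln x / (2 * ln g%:R)))) by ring.
by rewrite ler_wpM2l ?ler_wpM2l //; lra.
Qed.
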